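(* For $n\geq 1$, $$f_n(312,213)=\sum_{k=1}^n k!\,c(n,k),$$ where $c(n,k)$ is the unsigned Stirling number of the first kind.
   Context: A forest on $[n]$ is an unordered rooted forest whose $n$ vertices are labeled bijectively by $[n]$. A forest avoids a pattern $\sigma\in\mathfrak{S}_k$ if for every vertex $v$, the sequence of labels along the path from the root of the tree containing $v$ down to $v$ contains no subsequence in the same relative order as $\sigma$. $f_n(\sigma_1,\ldots,\sigma_m)$ is the number of forests on $[n]$ avoiding every $\sigma_i$. (Forests avoiding $312$ and $213$ are exactly those in which labels along every root-to-vertex path first increase then decrease.) $c(n,k)$ is the number of permutations of $[n]$ with exactly $k$ disjoint cycles. *)

(* Defs.v *)
From mathcomp Require Import all_boot all_fingroup.

Set Implicit Arguments.
Unset Strict Implicit.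
Unset Printing Implicit Defensive.

(* A rooted forest on n labelled vertices is encoded by its parent map:
   [f v = None] when v is a root, [f v = Some u] when u is the parent of v.
   Vertices are identified with their labels, and {0, ..., n-1} stands for
   {1, ..., n}; only the relative order of labels matters. *)
Definition parent_map (n : nat) := {ffun 'I_n -> option 'I_n}.

Definition parent_rel (n : nat) (f : parent_map n) : rel 'I_n :=
  fun v u => f v == Some u.

(* No directed cycle: a parent of v never has v among its (weak) ancestors. *)
Definition is_forest (n : nat) (f : parent_map n) : bool :=
  [forall v, forall u, parent_rel f v u ==> ~~ connect (parent_rel f) u v].

(* Labels from the root down to v. In a forest the path has at most n
   vertices, and the iterates past the root are [None], which [pmap] drops. *)
Definition root_path (n : nat) (f : parent_map n) (v : 'I_n) : seq 'I_n :=
  rev (pmap id (traject (obind f) (Some v) n)).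

Definition same_relative_order (s t : seq nat) : bool :=
  (size s == size t) &&
  [forall i : 'I_(size s), forall j : 'I_(size s),
     (nth 0 s i < nth 0 s j) == (nth 0 t i < nth 0 t j)].

(* Patterns are permutations in one-line notation; subsequences of w are the
   [mask m w]. *)
Definition contains_pattern (sigma w : seq nat) : bool :=
  [exists m : (size w).-tuple bool, same_relative_order sigma (mask m w)].

Definition avoids (n : nat) (f : parent_map n) (sigma : seq nat) : bool :=
  [forall v, ~~ contains_pattern sigma (map val (root_path f v))].

Definition forest_count (n : nat) (sigmas : seq (seq nat)) : nat :=
  #|[set f : parent_map n | is_forest f && all (avoids f) sigmas]|.

(* [porbits s] is the set of all cycles of s, fixed points included. *)
Definition stirling1 (n k : nat) : nat :=
  #|[set s : 'S_n | #|porbits s| == k]|.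

(* Main.v *)
(** Delete the least label of a unimodal forest.  That label is either a
non-root leaf, which can hang from any of the other vertices, or a root, whose
children are an arbitrary set of roots of the remaining forest.  Hence
G_n(m) = sum over unimodal forests of m^(number of roots) satisfies
G_(n+1)(m) = m G_n(m+1) + n G_n(m).  The sum over permutations of [n] of the
rising factorial m (m+1) ... (m+k-1), k being the number of cycles, obeys the
same recurrence: the least element is either fixed or inserted in a cycle just
before another element.  At m = 1 the rising factorial is k!. *)

Require Import Defs.
From mathcomp Require Import all_boot all_fingroup.
From mathcomp Require Import zify.
Set Implicit Arguments.
Unset Strict Implicit.
Unset Printing Implicit Defensive.

(** * Strict ancestry and acyclicity *)

(** Since [connect] is reflexive, a first parent step is split off; [proper_ancestor f x x] then
    says that [x] lies on a cycle. *)
Definition proper_ancestor (n : nat) (f : parent_map n) : rel 'I_n :=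
  fun x y => [exists u, parent_rel f x u && connect (parent_rel f) u y].

Lemma proper_ancestorP (n : nat) (f : parent_map n) (x y : 'I_n) :
  reflect (exists2 u, f x = Some u & connect (parent_rel f) u y)
          (proper_ancestor f x y).
Proof.
apply: (iffP existsP) => [[u /andP[/eqP]]|[u fx uy]]; exists u => //.
by rewrite /parent_rel fx eqxx.
Qed.

Lemma proper_ancestor_parent (n : nat) (f : parent_map n) :
  subrel (parent_rel f) (proper_ancestor f).
Proof. by move=> x u /eqP fx; apply/proper_ancestorP; exists u. Qed.

Lemma connect_proper_ancestor (n : nat) (f : parent_map n) (x y : 'I_n) :
  connect (parent_rel f) x y = (x == y) || proper_ancestor f x y.
Proof.
apply/idP/orP => [/connectP[[|u p] /=]|].
- by move=> _ ->; left.
- move=> /andP[/eqP fx pth] ->; right; apply/proper_ancestorP; exists u => //.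
  by apply/connectP; exists p.
case=> [/eqP-> //|/proper_ancestorP[u fx]].
by apply: connect_trans; apply: connect1; rewrite /parent_rel fx.
Qed.

Lemma proper_ancestor_trans (n : nat) (f : parent_map n) :
  transitive (proper_ancestor f).
Proof.
move=> y x z /proper_ancestorP[u fx uy] yz; apply/proper_ancestorP.
exists u => //; apply: connect_trans uy _.
by rewrite connect_proper_ancestor yz orbT.
Qed.

Lemma proper_ancestor_path (n : nat) (f : parent_map n) (x y : 'I_n) :
  proper_ancestor f x y ->
  exists u p, path (parent_rel f) x (u :: p) /\ y = last u p.
Proof.
move=> /proper_ancestorP[u fx /connectP[p pth ->]]; exists u, p.
by rewrite /= pth andbT /parent_rel fx.
Qed.

(* A valley along a root path is what 312 and 213 both forbid. *)
Definition unimodal_forest (n : nat) (f : parent_map n) : bool :=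
  [forall x, ~~ proper_ancestor f x x] &&
  [forall x, forall y, forall z,
     proper_ancestor f x y && proper_ancestor f y z ==>
     ~~ ((y < x) && (y < z))].

Lemma is_forestE (n : nat) (f : parent_map n) :
  is_forest f = [forall x, ~~ proper_ancestor f x x].
Proof.
apply/forallP/forallP => H x.
  apply/negP=> /proper_ancestorP[u fx ux].
  by have /forallP/(_ u) := H x; rewrite /parent_rel fx eqxx ux.
apply/forallP=> u; apply/implyP=> /eqP fx; apply/negP=> ux.
by case/negP: (H x); apply/proper_ancestorP; exists u.
Qed.

(** * Root paths and the two forbidden patterns *)

(** This is [root_path] before reversal, with the number of iterates left free for induction. *)
Definition ancestor_line (n : nat) (f : parent_map n) (x : 'I_n) (k : nat) :=
  pmap id (traject (obind f) (Some x) k).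

Lemma ancestor_lineS (n : nat) (f : parent_map n) (x : 'I_n) (k : nat) :
  ancestor_line f x k.+1 =
  x :: (if f x is Some u then ancestor_line f u k else [::]).
Proof.
rewrite /ancestor_line /=; congr (_ :: _); case: (f x) => //.
by elim: k => //= k ->.
Qed.

Lemma ancestor_line_sorted (n : nat) (f : parent_map n) (x : 'I_n) (k : nat) :
  sorted (proper_ancestor f) (ancestor_line f x k).
Proof.
elim: k x => [//|k IHk] x; rewrite ancestor_lineS.
case fx: (f x) => [u|] //=; have := IHk u; case: k {IHk} => // k.
rewrite ancestor_lineS /= => ->; rewrite andbT.
by apply: proper_ancestor_parent; rewrite /parent_rel fx.
Qed.

Lemma prefix_ancestor_line (n : nat) (f : parent_map n) (x : 'I_n) p (k : nat) :
  path (parent_rel f) x p -> size p < k -> prefix (x :: p) (ancestor_line f x k).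
Proof.
elim: p x k => [|u p IHp] x [|k] //; rewrite ancestor_lineS prefix_cons eqxx.
  by move=> _ _; rewrite prefix0s.
by case/andP=> /eqP -> pth lt_pk; apply: IHp.
Qed.

(** By acyclicity the path from [x] through [y] to [z] repeats no vertex, so it has at most [n] of
    them and [n] iterates reach its end. *)
Lemma sub_ancestor_line (n : nat) (f : parent_map n) (x y z : 'I_n) :
  is_forest f -> proper_ancestor f x y -> proper_ancestor f y z ->
  subseq [:: x; y; z] (ancestor_line f x n).
Proof.
rewrite is_forestE => /forallP acyc.
move=> /proper_ancestor_path[u [p [pth_p ->]]].
move=> /proper_ancestor_path[v [q [pth_q ->]]].
have pth : path (parent_rel f) x ((u :: p) ++ v :: q) by rewrite cat_path pth_p.
have uniq_pth : uniq (x :: (u :: p) ++ v :: q).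
  apply: (sorted_uniq (@proper_ancestor_trans _ f)).
    by move=> w; apply: negPf.
  exact: sub_path (@proper_ancestor_parent _ f) _ _ pth.
have lt_n : size ((u :: p) ++ v :: q) < n.
  have := max_card (mem (x :: (u :: p) ++ v :: q)).
  by rewrite card_ord (card_uniqP uniq_pth).
have /prefixP[r ->] := prefix_ancestor_line pth lt_n.
apply: subseq_trans (prefix_subseq _ r).
apply: (@cat_subseq _ [:: x] [:: _; _] [:: x]) (subseq_refl _) _.
apply: (@cat_subseq _ [:: _] [:: _] (u :: p)); by rewrite sub1seq mem_last.
Qed.

Lemma contains_patternP (sigma w : seq nat) :
  reflect (exists2 t, subseq t w & same_relative_order sigma t)
          (contains_pattern sigma w).
Proof.
apply: (iffP existsP) => [[m ord_m]|[t /subseqP[m size_m ->] ord_m]].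
  by exists (mask m w); rewrite ?mask_subseq.
by exists (tcast size_m (in_tuple m)); rewrite val_tcast.
Qed.

(** Comparing entries of consecutive rank suffices; the remaining comparisons follow by
    transitivity. *)
Lemma same_relative_order_312 (a b c : nat) :
  same_relative_order [:: 3; 1; 2] [:: a; b; c] = (b < c) && (c < a).
Proof.
apply/andP/andP => [[_ /forallP H]|[lt_bc lt_ca]].
  have /eqP/= := forallP (H (@Ordinal 3 1 isT)) (@Ordinal 3 2 isT).
  by have /eqP/= := forallP (H (@Ordinal 3 2 isT)) (@Ordinal 3 0 isT).
split=> //; apply/forallP=> -[[|[|[|//]]] hi]; apply/forallP=> -[[|[|[|//]]] hj] /=;
  apply/eqP; lia.
Qed.

Lemma same_relative_order_213 (a b c : nat) :
  same_relative_order [:: 2; 1; 3] [:: a; b; c] = (b < a) && (a < c).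
Proof.
apply/andP/andP => [[_ /forallP H]|[lt_ba lt_ac]].
  have /eqP/= := forallP (H (@Ordinal 3 1 isT)) (@Ordinal 3 0 isT).
  by have /eqP/= := forallP (H (@Ordinal 3 0 isT)) (@Ordinal 3 2 isT).
split=> //; apply/forallP=> -[[|[|[|//]]] hi]; apply/forallP=> -[[|[|[|//]]] hj] /=;
  apply/eqP; lia.
Qed.

Lemma same_relative_order_size (s t : seq nat) :
  same_relative_order s t -> size t = size s.
Proof. by case/andP=> /eqP. Qed.

(** Ancestry is transitive, so it holds pairwise along the ancestor line, not only between
    neighbours. The root path is read downwards, hence the reversed order in [t]. *)
Lemma proper_ancestor_subseq (n : nat) (f : parent_map n) (v : 'I_n) (t : seq nat) :
  subseq t (map val (root_path f v)) -> size t = 3 ->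
  exists x y z : 'I_n, [/\ t = [:: val z; val y; val x],
    proper_ancestor f x y & proper_ancestor f y z].
Proof.
move=> /subseqP[m _ ->]; rewrite -map_mask size_map.
set t' := mask m _ => size_t.
have : pairwise (proper_ancestor f) (rev t').
  apply: (subseq_pairwise (ys := ancestor_line f v n)).
    by rewrite -[ancestor_line f v n]revK subseq_rev mask_subseq.
  rewrite -(sorted_pairwise (@proper_ancestor_trans _ f)).
  exact: ancestor_line_sorted.
move: size_t; case: t' => [|z [|y [|x [|? ?]]]] //= _.
rewrite /rev /= !andbT => /andP[/andP[xy _] yz].
by exists x, y, z.
Qed.

Lemma unimodal_forestE (n : nat) (f : parent_map n) :
  is_forest f && all (avoids f) [:: [:: 3; 1; 2]; [:: 2; 1; 3]] =
  unimodal_forest f.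
Proof.
rewrite /unimodal_forest -is_forestE; case forest_f: (is_forest f) => //=.
rewrite andbT; apply/andP/forallP => [[/forallP no312 /forallP no213] x|novalley].
  apply/forallP=> y; apply/forallP=> z; apply/implyP=> /andP[xy yz].
  have sub : subseq [:: val z; val y; val x] (map val (root_path f x)).
    have := sub_ancestor_line forest_f xy yz.
    rewrite -subseq_rev => /subseqP[m _].
    rewrite /rev /= => eq_m; rewrite -[[:: _; _; _]]/(map val [:: z; y; x]) eq_m.
    by rewrite map_mask mask_subseq.
  have neq_xz : x != z :> nat.
    apply/eqP=> /val_inj eq_xz; move: forest_f; rewrite is_forestE.
    move=> /forallP/(_ x)/negP; apply.
    by rewrite {2}eq_xz; apply: proper_ancestor_trans xy yz.
  apply/negP=> /andP[lt_yx lt_yz].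
  (* Read from the root, the valley is [z], [y], [x]: it is a 312 if [x < z] and a 213 if
     [z < x]. *)
  case: (ltngtP x z) neq_xz => // [lt_xz|lt_zx] _.
    case/contains_patternP: (no312 x); eexists; first exact: sub.
    by rewrite same_relative_order_312 lt_yx.
  case/contains_patternP: (no213 x); eexists; first exact: sub.
  by rewrite same_relative_order_213 lt_yz.
split; apply/forallP=> v; apply/contains_patternP=> -[t sub ord_t].
  have [x [y [z [eq_t xy yz]]]] :=
    proper_ancestor_subseq sub (same_relative_order_size ord_t).
  have /forallP/(_ y)/forallP/(_ z) := novalley x; rewrite xy yz /=.
  move: ord_t; rewrite eq_t same_relative_order_312 => /andP[lt_yx lt_xz].
  by rewrite lt_yx (ltn_trans lt_yx lt_xz).
have [x [y [z [eq_t xy yz]]]] :=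
  proper_ancestor_subseq sub (same_relative_order_size ord_t).
have /forallP/(_ y)/forallP/(_ z) := novalley x; rewrite xy yz /=.
move: ord_t; rewrite eq_t same_relative_order_213 => /andP[lt_yz lt_zx].
by rewrite lt_yz (ltn_trans lt_yz lt_zx).
Qed.

(** * Cycle counts when a least element is inserted into a permutation *)

Lemma expg_lift_perm (n : nat) (s : 'S_n) (i : nat) (x : 'I_n) :
  (lift_perm ord0 ord0 s ^+ i)%g (lift ord0 x) = lift ord0 ((s ^+ i)%g x).
Proof.
elim: i => [|i IHi]; first by rewrite !expg0 !perm1.
by rewrite !expgSr !permM IHi lift_perm_lift.
Qed.

Lemma porbit_lift_perm (n : nat) (s : 'S_n) (x : 'I_n) :
  porbit (lift_perm ord0 ord0 s) (lift ord0 x) = lift ord0 @: porbit s x.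
Proof.
apply/setP=> y; apply/porbitP/imsetP => [[i ->]|[_ /porbitP[i ->] ->]].
  by exists ((s ^+ i)%g x); rewrite ?mem_porbit ?expg_lift_perm.
by exists i; rewrite expg_lift_perm.
Qed.

Lemma porbit_lift_perm0 (n : nat) (s : 'S_n) :
  porbit (lift_perm ord0 ord0 s) ord0 = [set ord0].
Proof.
apply/setP=> y; rewrite inE; apply/porbitP/eqP => [[i ->]|->]; last first.
  by exists 0; rewrite expg0 perm1.
by elim: i => [|i IHi]; rewrite ?expg0 ?perm1 // expgSr permM IHi lift_perm_id.
Qed.

(** The cycles are the lifted cycles of [s] together with the singleton of the new fixed point. *)
Lemma card_porbits_lift_perm (n : nat) (s : 'S_n) :
  #|porbits (lift_perm ord0 ord0 s)| = #|porbits s|.+1.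
Proof.
have -> : porbits (lift_perm ord0 ord0 s) =
    [set ord0] |: ((fun A : {set 'I_n} => lift ord0 @: A) @: porbits s).
  apply/setP=> A; rewrite in_setU1; apply/imsetP/orP.
    case=> x _ ->; case: (unliftP ord0 x) => [y ->|->].
      by right; rewrite porbit_lift_perm; do 2!apply: imset_f.
    by left; rewrite porbit_lift_perm0.
  case=> [/eqP->|/imsetP[_ /imsetP[x _ ->] ->]].
    by exists ord0; rewrite ?porbit_lift_perm0.
  by exists (lift ord0 x); rewrite ?porbit_lift_perm.
rewrite cardsU1 card_imset; last exact/imset_inj/lift_inj.
rewrite [_ \notin _](_ : _ = true) //.
apply/imsetP=> -[A _ /setP/(_ ord0)]; rewrite set11 => /esym/imsetP[x _ /eqP].
by rewrite (negPf (neq_lift ord0 x)).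
Qed.

(** The transposition joins two distinct cycles, absorbing the fixed point 0 into the cycle of [j],
    which cancels the extra cycle. *)
Lemma card_porbits_tperm_lift (n : nat) (s : 'S_n) (j : 'I_n) :
  #|porbits (tperm ord0 (lift ord0 j) * lift_perm ord0 ord0 s)%g| =
  #|porbits s|.
Proof.
have := porbits_mul_tperm (lift_perm ord0 ord0 s) ord0 (lift ord0 j).
rewrite /= porbit_sym porbit_lift_perm0 inE card_porbits_lift_perm.
by rewrite eq_sym neq_lift addn1 addn2 => -[].
Qed.

Lemma lift_perm0_inj (n : nat) : injective (@lift_perm n ord0 ord0).
Proof.
move=> s t /permP st; apply/permP=> x; apply: (@lift_inj _ ord0).
by rewrite -!(lift_perm_lift ord0) st.
Qed.

(** The index [j] is recovered as the preimage of 0, and the transposition then cancels; equal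
    cardinalities give surjectivity. *)
Lemma tperm_lift_perm_bij (n : nat) :
  bijective (fun p : 'I_n.+1 * 'S_n =>
    (tperm ord0 p.1 * lift_perm ord0 ord0 p.2)%g).
Proof.
apply: inj_card_bij => [[j s] [k t] /= eq_jk|]; last first.
  by rewrite card_prod !card_Sn card_ord.
have jk : j = k.
  apply: (@perm_inj _ (tperm ord0 k * lift_perm ord0 ord0 t)%g).
  by rewrite -{1}eq_jk !permM !tpermR !lift_perm_id.
by move: eq_jk; rewrite jk => /mulgI/lift_perm0_inj ->.
Qed.

Lemma sum_porbitsS (n : nat) (h : nat -> nat) :
  \sum_(s : 'S_n.+1) h #|porbits s| =
  \sum_(s : 'S_n) h #|porbits s|.+1 + n * \sum_(s : 'S_n) h #|porbits s|.
Proof.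
rewrite (reindex _ (onW_bij _ (@tperm_lift_perm_bij n))) /=.
rewrite -(pair_bigA _ (fun j s =>
  h #|porbits (tperm ord0 j * lift_perm ord0 ord0 s)%g|)) /=.
rewrite big_ord_recl; congr (_ + _).
  by apply: eq_bigr => s _; rewrite tperm1 mul1g card_porbits_lift_perm.
rewrite (eq_bigr (fun=> \sum_(s : 'S_n) h #|porbits s|)) => [|j _].
  by rewrite sum_nat_const card_ord.
by apply: eq_bigr => s _; rewrite card_porbits_tperm_lift.
Qed.

Lemma sum_porbits_stirling1 (n : nat) (h : nat -> nat) : 0 < n ->
  \sum_(s : 'S_n) h #|porbits s| = \sum_(1 <= k < n.+1) h k * stirling1 n k.
Proof.
move=> n_gt0.
have le_n (s : 'S_n) : #|porbits s| < n.+1.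
  by rewrite ltnS -[leqRHS]card_ord leq_imset_card.
have card_gt0 (s : 'S_n) : 0 < #|porbits s|.
  by apply/card_gt0P; exists (porbit s (Ordinal n_gt0)); apply: imset_f.
rewrite (partition_big (fun s : 'S_n => Ordinal (le_n s)) xpredT) //=.
have sumE (k : 'I_n.+1) :
    \sum_(s : 'S_n | Ordinal (le_n s) == k) h #|porbits s| =
    h k * stirling1 n k.
  rewrite (eq_bigr (fun=> h k)) => [|s /eqP <- //].
  by rewrite sum_nat_const mulnC /stirling1 cardsE.
rewrite (eq_bigr (fun k : 'I_n.+1 => h k * stirling1 n k)) => [|k _ //].
rewrite -(big_mkord xpredT (fun k => h k * stirling1 n k)) big_ltn //.
(* The term [k = 0] vanishes because a permutation of a nonempty set has a cycle. *)
rewrite [stirling1 n 0](_ : _ = 0) ?muln0 //.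
by apply/eqP; rewrite cards_eq0; apply/eqP/setP=> s; rewrite !inE eqn0Ngt card_gt0.
Qed.

(** * Deleting the least label of a forest *)

(** Both [None] and [Some ord0] are sent to [None], so the children of the deleted vertex become
    roots. *)
Definition above_min (n : nat) (f : parent_map n.+1) : parent_map n :=
  [ffun v => obind (unlift ord0) (f (lift ord0 v))].

Definition min_terminal (n : nat) (f : parent_map n.+1) : bool :=
  (f ord0 == None) || [forall v, f v != Some ord0].

Lemma proper_ancestor_lastP (n : nat) (f : parent_map n) (x y : 'I_n) :
  proper_ancestor f x y -> exists v, f v = Some y.
Proof.
move=> /proper_ancestor_path[u [p [pth ->]]].
rewrite lastI rcons_path /= in pth.
by case/andP: pth => _ /eqP; exists (last x (belast u p)).
Qed.

Lemma min_terminalN (n : nat) (f : parent_map n.+1) (x y : 'I_n.+1) :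
  min_terminal f -> ~~ (proper_ancestor f x ord0 && proper_ancestor f ord0 y).
Proof.
move=> term_f; apply/negP=> /andP[/proper_ancestor_lastP[v fv]].
move=> /proper_ancestorP[u f0 _]; case/orP: term_f; first by rewrite f0.
by move/forallP/(_ v); rewrite fv eqxx.
Qed.

(** A path between two other vertices could only meet 0 in its interior, where 0 would have both a
    child and a parent. *)
Lemma connect_above_min (n : nat) (f : parent_map n.+1) (x y : 'I_n) :
  min_terminal f ->
  connect (parent_rel f) (lift ord0 x) (lift ord0 y) =
  connect (parent_rel (above_min f)) x y.
Proof.
move=> term_f; apply/connectP/connectP => -[p].
  elim: p x => [|u p IHp] x /=; first by move=> _ /lift_inj ->; exists [::].
  case/andP=> /eqP fx; case: (unliftP ord0 u) => [u'|] ->{u} in fx *.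
    move=> pth /(IHp _ pth)[q pth_q ->]; exists (u' :: q) => //=.
    by rewrite pth_q /parent_rel ffunE fx /= liftK eqxx.
  case: p {IHp} => [|u p] /=; first by move=> _ /eqP; rewrite eq_sym (negPf (neq_lift _ _)).
  case/andP=> /eqP f0 _ _; case/orP: term_f; first by rewrite f0.
  by move/forallP/(_ (lift ord0 x)); rewrite fx eqxx.
elim: p x => [|u p IHp] x /=; first by move=> _ ->; exists [::].
case/andP=> /eqP; rewrite ffunE; case fx: (f (lift ord0 x)) => [u'|] //=.
case: (unliftP ord0 u') => // u0 eq_u' [<-] pth eq_y.
have [q pth_q ->] := IHp u0 pth eq_y.
by exists (lift ord0 u0 :: q); rewrite //= pth_q /parent_rel fx eq_u' eqxx.
Qed.

Lemma proper_ancestor_above_min (n : nat) (f : parent_map n.+1) (x y : 'I_n) :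
  min_terminal f ->
  proper_ancestor f (lift ord0 x) (lift ord0 y) =
  proper_ancestor (above_min f) x y.
Proof.
move=> term_f; apply/proper_ancestorP/proper_ancestorP => -[u].
  move=> fx; case: (unliftP ord0 u) => [u'|] eq_u; rewrite eq_u in fx *.
    rewrite connect_above_min // => uy; exists u' => //.
    by rewrite ffunE fx /= liftK.
  rewrite connect_proper_ancestor (negPf (neq_lift _ _)) /= => uy.
  case/negP: (min_terminalN (lift ord0 x) (lift ord0 y) term_f); rewrite uy andbT.
  by apply: proper_ancestor_parent; rewrite /parent_rel fx.
rewrite ffunE; case fx: (f (lift ord0 x)) => [u'|] //=.
case: (unliftP ord0 u') => // u0 eq_u' [<-] uy.
by exists u'; rewrite // eq_u' connect_above_min.
Qed.

(** A child and a parent of 0 would differ from 0 by acyclicity, hence be larger, and form a valley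
    with it. *)
Lemma unimodal_forest_min_terminal (n : nat) (f : parent_map n.+1) :
  unimodal_forest f -> min_terminal f.
Proof.
case/andP=> /forallP acyc /forallP novalley; apply/norP=> -[].
case f0: (f ord0) => [u|] // _ /forallPn[v]; rewrite negbK => /eqP fv.
have v0 : proper_ancestor f v ord0.
  by apply: proper_ancestor_parent; rewrite /parent_rel fv.
have u0 : proper_ancestor f ord0 u.
  by apply: proper_ancestor_parent; rewrite /parent_rel f0.
have /forallP/(_ ord0)/forallP/(_ u) := novalley v; rewrite v0 u0 /=.
case: (unliftP ord0 v) v0 => [v' ->|->]; last by rewrite (negPf (acyc ord0)).
by case: (unliftP ord0 u) u0 => [u' ->|->]; last by rewrite (negPf (acyc ord0)).
Qed.

(* The least label sits at an end of every path through it, so deleting it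
   neither destroys nor creates a valley. *)
Lemma unimodal_forestS (n : nat) (f : parent_map n.+1) :
  unimodal_forest f = unimodal_forest (above_min f) && min_terminal f.
Proof.
apply/idP/andP => [uni_f|[/andP[/forallP acyc /forallP novalley] term_f]].
  have term_f := unimodal_forest_min_terminal uni_f; split=> //.
  case/andP: uni_f => /forallP acyc /forallP novalley; apply/andP; split.
    by apply/forallP=> x; rewrite -proper_ancestor_above_min.
  apply/forallP=> x; apply/forallP=> y; apply/forallP=> z.
  rewrite -!proper_ancestor_above_min //.
  by have /forallP/(_ (lift ord0 y))/forallP/(_ (lift ord0 z)) := novalley (lift ord0 x).
apply/andP; split; apply/forallP=> x.
  case: (unliftP ord0 x) => [x'|] ->; first by rewrite proper_ancestor_above_min.
  by have := min_terminalN ord0 ord0 term_f; rewrite andbb.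
apply/forallP=> y; apply/forallP=> z; apply/implyP=> /andP[xy yz].
case: (unliftP ord0 y) xy yz => [y'|] -> xy yz; last first.
  by case/negP: (min_terminalN x z term_f); rewrite xy.
case: (unliftP ord0 x) xy => [x'|] -> xy //.
case: (unliftP ord0 z) yz => [z'|] -> yz; last by rewrite andbF.
have /forallP/(_ y')/forallP/(_ z') := novalley x'.
by rewrite -!proper_ancestor_above_min // xy yz.
Qed.

(** * Counting forests weighted by their roots *)

Definition root_weight (n m : nat) (o : option 'I_n) : nat :=
  if o is Some _ then 1 else m.

(** This is [m] to the number of roots, written as a product over vertices so that sums over parent
    maps factor. *)
Definition forest_weight (n m : nat) (f : parent_map n) : nat :=
  \prod_v root_weight m (f v).

(** A root of the smaller forest was a root, of weight [m], or a child of 0, of weight 1; any other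
    vertex keeps its parent. *)
Lemma sum_root_weight_above (n m : nat) (o : option 'I_n) :
  \sum_(o' : option 'I_n.+1 | obind (unlift ord0) o' == o) root_weight m o' =
  root_weight m.+1 o.
Proof.
case: o => [u|] /=.
  rewrite (big_pred1 (Some (lift ord0 u))) // => -[u'|] //=.
  case: (unliftP ord0 u') => [u''|] ->.
    by rewrite /= !(inj_eq Some_inj) (inj_eq lift_inj).
  by rewrite /= (inj_eq Some_inj) (negPf (neq_lift _ _)).
rewrite (bigD1 None) //= (big_pred1 (Some ord0)) ?addn1 // => -[u|] //=.
by case: (unliftP ord0 u) => [u'|] -> //=; rewrite andbT (inj_eq Some_inj) eq_sym neq_lift.
Qed.

Lemma sum_root_weight_above_neq0 (n m : nat) (o : option 'I_n) :
  \sum_(o' : option 'I_n.+1 | (obind (unlift ord0) o' == o) && (o' != Some ord0))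
     root_weight m o' = root_weight m o.
Proof.
have := sum_root_weight_above m o; rewrite (bigID (pred1 (Some ord0))) /=.
case: o => [u|] /=.
  rewrite big_pred0 ?add0n // => o'; apply/negP=> /andP[/eqP eq_o' /eqP o'0].
  by rewrite o'0 /= unlift_none in eq_o'.
rewrite (big_pred1 (Some ord0)); first by rewrite add1n => -[].
move=> o' /=; case: (o' =P Some ord0) => [->|]; rewrite ?andbF //=.
by rewrite unlift_none.
Qed.

(** These [o] are the possible parents of 0 when it is a non-root leaf, each of weight 1. *)
Lemma sum_root_weight_lift (n m : nat) :
  \sum_(o : option 'I_n.+1 | obind (unlift ord0) o) root_weight m o = n.
Proof.
rewrite (reindex_omap (fun u : 'I_n => Some (lift ord0 u)) (obind (unlift ord0))) /=.
  rewrite (eq_bigl xpredT) => [|u]; last by rewrite /= liftK /= eqxx.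
  by rewrite sum1_card card_ord.
by case=> //= u; case: unliftP => [v ->|].
Qed.

(** The conditions on [f] are independent at each vertex, so the sum of products is a product of
    sums: [m] at 0 and [root_weight m.+1] elsewhere. *)
Lemma sum_forest_weight_fiber_root (n m : nat) (g : parent_map n) :
  \sum_(f : parent_map n.+1 | (above_min f == g) && (f ord0 == None))
     forest_weight m f = m * forest_weight m.+1 g.
Proof.
pose Q (v : 'I_n.+1) : pred (option 'I_n.+1) := fun o =>
  if unlift ord0 v is Some w then obind (unlift ord0) o == g w else o == None.
rewrite (eq_bigl (fun f => f \in family Q)) => [|f].
  rewrite -(bigA_distr_big_dep Q (fun _ => root_weight m)) big_ord_recl.
  rewrite /Q unlift_none big_pred1_eq; congr (_ * _); apply: eq_bigr => v _.
  by rewrite liftK sum_root_weight_above.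
apply/andP/familyP => [[/eqP eq_g f0] v|Qf].
  by rewrite /in_mem /= /Q -eq_g; case: unliftP => [w|] ->; rewrite ?ffunE.
split; last by have := Qf ord0; rewrite /in_mem /= /Q unlift_none.
apply/eqP/ffunP=> v; have := Qf (lift ord0 v).
by rewrite /in_mem /= /Q liftK ffunE => /eqP.
Qed.

Lemma sum_forest_weight_fiber_leaf (n m : nat) (g : parent_map n) :
  \sum_(f : parent_map n.+1 |
      [&& above_min f == g, f ord0 != None & [forall v, f v != Some ord0]])
     forest_weight m f = n * forest_weight m g.
Proof.
pose Q (v : 'I_n.+1) : pred (option 'I_n.+1) := fun o =>
  if unlift ord0 v is Some w
  then (obind (unlift ord0) o == g w) && (o != Some ord0)
  else obind (unlift ord0) o.
(* At the vertex 0, being a non-root leaf also rules out 0 as its own parent. *)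
have QE (o : option 'I_n.+1) :
    obind (unlift ord0) o = (o != None) && (o != Some ord0) :> bool.
  by case: o => [u|] //=; case: unliftP => [v|] ->; rewrite ?eqxx.
rewrite (eq_bigl (fun f => f \in family Q)) => [|f].
  rewrite -(bigA_distr_big_dep Q (fun _ => root_weight m)) big_ord_recl.
  rewrite /Q unlift_none sum_root_weight_lift; congr (_ * _).
  by apply: eq_bigr => v _; rewrite liftK sum_root_weight_above_neq0.
apply/and3P/familyP => [[/eqP eq_g f0 /forallP f_neq] v|Qf].
  by rewrite /in_mem /= /Q -eq_g; case: unliftP => [w|] ->; rewrite ?QE ?ffunE ?eqxx f_neq ?f0.
have f0 : (f ord0 != None) && (f ord0 != Some ord0).
  by have := Qf ord0; rewrite /in_mem /= /Q unlift_none QE.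
have fS v : (above_min f v == g v) && (f (lift ord0 v) != Some ord0).
  by have := Qf (lift ord0 v); rewrite /in_mem /= /Q liftK ffunE.
split; first by apply/eqP/ffunP=> v; case/andP: (fS v) => /eqP.
  by case/andP: f0.
apply/forallP=> v; case: (unliftP ord0 v) => [w|] ->; first by case/andP: (fS w).
by case/andP: f0.
Qed.

(** Forests are grouped by what remains after deleting 0, and each fiber is split according to
    whether 0 is a root or a non-root leaf. *)
Lemma sum_forest_weightS (n m : nat) :
  \sum_(f : parent_map n.+1 | unimodal_forest f) forest_weight m f =
  m * (\sum_(f : parent_map n | unimodal_forest f) forest_weight m.+1 f) +
  n * \sum_(f : parent_map n | unimodal_forest f) forest_weight m f.
Proof.
rewrite (partition_big (@above_min n) (@unimodal_forest n)) => [|f]; last first.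
  by rewrite unimodal_forestS => /andP[].
rewrite !big_distrr -big_split; apply: eq_bigr => g uni_g /=.
rewrite (bigID (fun f : parent_map n.+1 => f ord0 == None)) /=.
rewrite -sum_forest_weight_fiber_root -sum_forest_weight_fiber_leaf.
congr (_ + _); apply: eq_bigl => f; rewrite unimodal_forestS /min_terminal;
  case: (above_min f =P g) => [->|_]; rewrite ?andbF // uni_g !andbT /=;
  by case: (f ord0 == None); rewrite ?andbF ?andbT.
Qed.

(** With [k] cycles, the summand is the rising factorial [m (m+1) ... (m+k-1)]; it is 1 for [k = 0],
    also when the predecessor truncates. *)
Lemma sum_forest_weight_porbits (n m : nat) :
  \sum_(f : parent_map n | unimodal_forest f) forest_weight m f =
  \sum_(s : 'S_n) (m + #|porbits s|).-1 ^_ #|porbits s|.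
Proof.
(* The weight [m] stays general because deleting a root raises it to [m.+1]. *)
elim: n m => [|n IHn] m.
  have porbits0 (s : 'S_0) : #|porbits s| = 0.
    by apply/eqP; rewrite cards_eq0 -subset0; apply/subsetP=> A /imsetP[[]].
  rewrite (eq_bigr (fun=> 1)) => [|f _]; last by rewrite /forest_weight big_ord0.
  rewrite [RHS](eq_bigr (fun=> 1)) => [|s _]; last by rewrite porbits0 ffactn0.
  rewrite !sum1_card card_Sn (eq_card (B := predT)) => [|f].
    by rewrite card_ffun card_ord.
  by apply/andP; split; apply/forallP=> -[].
rewrite (sum_porbitsS n (fun k => (m + k).-1 ^_ k)) sum_forest_weightS !IHn.
congr (_ + _); rewrite big_distrr; apply: eq_bigr => s _ /=.
(* The last factor of the falling factorial, [m + k - k = m], is split off. *)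
by rewrite addnS /= ffactnSr addnK mulnC.
Qed.

Theorem theorem4p1 (n : nat) (hn : 1 <= n) :
  forest_count n [:: [:: 3; 1; 2]; [:: 2; 1; 3]] =
  \sum_(1 <= k < n.+1) k`! * stirling1 n k.
Proof.
rewrite -(sum_porbits_stirling1 factorial hn).
rewrite /forest_count -sum1_card.
(* At [m = 1] every forest has weight 1 and the rising factorial is [k!]. *)
rewrite [LHS](_ : _ = \sum_(f : parent_map n | unimodal_forest f) forest_weight 1 f).
  rewrite sum_forest_weight_porbits; apply: eq_bigr => s _.
  by rewrite add1n ffactnn.
apply: eq_big => [f|f _]; first by rewrite inE unimodal_forestE.
by rewrite /forest_weight big1 // => v _; case: (f v).
Qed.
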